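(* Consider the two-dimensional Kepler problem $\ddot x=-\frac{x}{|x|^3}$, $x=(x_1,x_2)\in\mathbf{R}^2\setminus\{0\}$, with Lagrangian $L(x,\dot x)=\frac12\dot x^\top\dot x+\frac1{|x|}$. The variational symmetries of $\int L\,dt$ associated with the energy $H$, the angular momentum $m$ and the components $A_1,A_2$ of the Laplace–Runge–Lenz vector are, respectively, $$\mathbf{v}_H=\dot x_1\frac{\partial}{\partial x_1}+\dot x_2\frac{\partial}{\partial x_2},\qquad \mathbf{v}_m=-x_2\frac{\partial}{\partial x_1}+x_1\frac{\partial}{\partial x_2},$$ $$\mathbf{v}_{A_1}=-x_2\dot x_2\frac{\partial}{\partial x_1}+(2x_1\dot x_2-\dot x_1x_2)\frac{\partial}{\partial x_2},\qquad \mathbf{v}_{A_2}=(2x_2\dot x_1-x_1\dot x_2)\frac{\partial}{\partial x_1}-x_1\dot x_1\frac{\partial}{\partial x_2}.$$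
   Context: The conserved quantities are $H=\frac12|\dot x|^2-\frac1{|x|}$, $m=x_1\dot x_2-x_2\dot x_1$, and $A_i=x_i|\dot x|^2-\dot x_i(x\cdot\dot x)-\frac{x_i}{|x|}$ for $i=1,2$. A generalized vector field is $\mathbf{v}=\sum_i v_i[x]\frac{\partial}{\partial x_i}$, where $[x]$ stands for $t$, $x$ and time derivatives of $x$; $(v_1,\dots,v_n)$ is its characteristic. Its infinite prolongation is $\operatorname{pr}\mathbf{v}=\mathbf{v}+\sum_i\sum_{j\ge1}\frac{d^jv_i}{dt^j}\frac{\partial}{\partial x_i^{(j)}}$ with $x_i^{(j)}=\frac{d^jx_i}{dt^j}$. $\mathbf{v}$ is a variational symmetry of $\int L[x]\,dt$ if $\operatorname{pr}\mathbf{v}(L)=\frac{d}{dt}K[x]$ for some function $K[x]$, identically. A conservation law $\frac{dP}{dt}=0$ of a system $N[x]=0$ has characteristic $Q[x]$ if $\frac{dP}{dt}=Q[x]N[x]$ identically. Here $N[x]=\ddot x+\frac{x}{|x|^3}$. A variational symmetry is associated with a conserved quantity $P$ if its characteristic $Q$ is the characteristic of the conservation law $\frac{dP}{dt}=0$, i.e. $\frac{dP}{dt}=Q_1N_1+Q_2N_2$ identically. *)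

(* Defs.v *)
From Stdlib Require Import Reals List Bool.
From Coquelicot Require Import Coquelicot.
Open Scope R_scope.

(** * Jets of planar curves *)

Inductive axis := X1 | X2.

Definition sum_axes (g : axis -> R) : R := g X1 + g X2.

(** A point [(t, z)] of the infinite jet space has time [t] and coordinates
    [z k i], standing for the [k]-th time derivative of [x_i].  All functions
    considered below depend on finitely many coordinates, and for those
    continuity for the uniform structure inferred here is joint continuity in
    the coordinates they depend on. *)
Definition jet : UniformSpace :=
  prod_UniformSpace R_UniformSpace
    (fct_UniformSpace nat (fct_UniformSpace axis R_UniformSpace)).

Inductive jvar := Vt | Vx (k : nat) (i : axis).

Definition coord (v : jvar) (J : jet) : R :=
  match v with Vt => fst J | Vx k i => snd J k i end.

Definition axis_eqb (i j : axis) : bool :=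
  match i, j with X1, X1 | X2, X2 => true | _, _ => false end.

Definition set_coord (v : jvar) (J : jet) (s : R) : jet :=
  match v with
  | Vt => (s, snd J)
  | Vx k i => (fst J, fun k' i' =>
      if Nat.eqb k' k && axis_eqb i' i then s else snd J k' i')
  end.

Definition position (i : axis) (J : jet) : R := coord (Vx 0 i) J.
Definition velocity (i : axis) (J : jet) : R := coord (Vx 1 i) J.
Definition acceleration (i : axis) (J : jet) : R := coord (Vx 2 i) J.

(** The jets over the configuration space [R^2 \ {0}]. *)
Definition dom (J : jet) : Prop := ~ (position X1 J = 0 /\ position X2 J = 0).

(** * Differential functions [f[x]] *)

Definition partial (v : jvar) (f : jet -> R) (J : jet) : R :=
  Derive (fun s => f (set_coord v J s)) (coord v J).

Fixpoint partials (l : list jvar) (f : jet -> R) : jet -> R :=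
  match l with nil => f | v :: l' => partial v (partials l' f) end.

Definition order_le (n : nat) (f : jet -> R) : Prop :=
  forall J J', dom J -> fst J = fst J' ->
    (forall k i, (k <= n)%nat -> snd J k i = snd J' k i) -> f J = f J'.

Definition smooth (f : jet -> R) : Prop :=
  forall l J, dom J ->
    continuous (partials l f) J /\
    forall v, ex_derive (fun s => partials l f (set_coord v J s)) (coord v J).

(** Values outside [dom] are irrelevant. *)
Definition differential_function (f : jet -> R) : Prop :=
  (exists n, order_le n f) /\ smooth f.

(** The total time derivative.  On differential functions only finitely many
    terms of the series are non-zero. *)
Definition Dt (f : jet -> R) (J : jet) : R :=
  partial Vt f J +
  Series (fun k =>
    sum_axes (fun i => coord (Vx (S k) i) J * partial (Vx k i) f J)).

(** * Generalized vector fields and conservation laws *)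

(** The vector field [sum_i v_i[x] d/dx_i] is given by its characteristic. *)
Definition gen_vector_field := axis -> jet -> R.

(** [pr v (f)]; the term [k = 0] is [v (f)], and again the series terminates
    on differential functions. *)
Definition pr (v : gen_vector_field) (f : jet -> R) (J : jet) : R :=
  Series (fun k =>
    sum_axes (fun i => Nat.iter k Dt (v i) J * partial (Vx k i) f J)).

Definition variational_symmetry (L : jet -> R) (v : gen_vector_field) : Prop :=
  (forall i, differential_function (v i)) /\
  exists K, differential_function K /\ forall J, dom J -> pr v L J = Dt K J.

(** [dP/dt = 0] is a conservation law of [N = 0] with characteristic [Q]. *)
Definition has_characteristic
    (N : axis -> jet -> R) (P : jet -> R) (Q : axis -> jet -> R) : Prop :=
  differential_function P /\
  forall J, dom J -> Dt P J = sum_axes (fun i => Q i J * N i J).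

Definition associated_symmetry
    (L : jet -> R) (N : axis -> jet -> R) (P : jet -> R)
    (v : gen_vector_field) : Prop :=
  variational_symmetry L v /\ has_characteristic N P v.

(** Characteristics that agree wherever [N = 0].  An associated symmetry is
    only determined up to this relation: adding [f * (- N_2, N_1)] to its
    characteristic changes neither [Q . N] nor its being a symmetry.  If [N]
    has the form [acceleration + F(position)], two characteristics depending
    only on [t], [position] and [velocity] are related exactly when they are
    equal on [dom]. *)
Definition agree_on_solutions
    (N : axis -> jet -> R) (v w : gen_vector_field) : Prop :=
  forall J, dom J -> (forall i, N i J = 0) -> forall i, v i J = w i J.

Definition is_the_associated_symmetry
    (L : jet -> R) (N : axis -> jet -> R) (P : jet -> R)
    (v : gen_vector_field) : Prop :=
  associated_symmetry L N P v /\
  forall w, associated_symmetry L N P w -> agree_on_solutions N w v.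

(** * The planar Kepler problem *)

Definition radius (J : jet) : R := sqrt (position X1 J ^ 2 + position X2 J ^ 2).
Definition speed2 (J : jet) : R := velocity X1 J ^ 2 + velocity X2 J ^ 2.
Definition pos_dot_vel (J : jet) : R :=
  position X1 J * velocity X1 J + position X2 J * velocity X2 J.

Definition kepler_L (J : jet) : R := / 2 * speed2 J + / radius J.
Definition kepler_N (i : axis) (J : jet) : R :=
  acceleration i J + position i J / radius J ^ 3.

Definition energy (J : jet) : R := / 2 * speed2 J - / radius J.
Definition angular_momentum (J : jet) : R :=
  position X1 J * velocity X2 J - position X2 J * velocity X1 J.
Definition LRL (i : axis) (J : jet) : R :=
  position i J * speed2 J - velocity i J * pos_dot_vel J
  - position i J / radius J.

Definition v_H : gen_vector_field := velocity.

Definition v_m : gen_vector_field := fun i J =>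
  match i with X1 => - position X2 J | X2 => position X1 J end.

Definition v_A1 : gen_vector_field := fun i J =>
  match i with
  | X1 => - position X2 J * velocity X2 J
  | X2 => 2 * position X1 J * velocity X2 J - velocity X1 J * position X2 J
  end.

Definition v_A2 : gen_vector_field := fun i J =>
  match i with
  | X1 => 2 * position X2 J * velocity X1 J - position X1 J * velocity X2 J
  | X2 => - position X1 J * velocity X1 J
  end.

(* Main.v *)
From Stdlib Require Import Reals Bool Lra Lia FunctionalExtensionality.
From Coquelicot Require Import Coquelicot.
Require Import Defs.
Open Scope R_scope.

(** For each of the four pairs, the identity [dP/dt = Q . N] is a computation
    with [r^2 = x_1^2 + x_2^2].  The rest follows from it by two general arguments.

    Noether's theorem, in the direction from conservation laws to symmetries:
    integrating by parts once, for any [Q],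
    [pr Q (L) = Q . dL/dx + dQ/dt . dL/dx' = d/dt (Q . x') - Q . N],
    because [N] is minus the Euler-Lagrange expression of [L].  When
    [Q . N = dP/dt], the right-hand side is [d/dt (Q . x' - P)], so [Q] is a
    variational symmetry with [K = Q . x' - P] (lemma
    [associated_of_characteristic]).

    Uniqueness: if [v] and [w] are both characteristics of [P], then
    [(w - v) . N = 0] on all jets.  At a jet with [N = 0], move only the
    acceleration [x_i'']: then [N_i] becomes non-zero while the other component
    of [N] stays zero, so [w_i - v_i] vanishes at all the moved jets, and by
    continuity at the original one (lemma [characteristic_unique]).

    Applying this to concrete functions requires smoothness to all orders on an
    infinite jet space, and values for the series that define [Dt] and [pr].
    All functions in sight are polynomials in the jet coordinates and [1/r].
    This algebra is closed under partial derivatives, since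
    [d(1/r) = - (x . dx) / r^3], so it is described by a syntax [expr] with
    partial derivatives computed formally ([pd]).  Smoothness is then an
    induction on the list of derivatives, and both series become a derivation
    of the algebra ([along]), computed by the Leibniz rule. *)

(** * The algebra of polynomials in the jet coordinates and 1/r *)

Inductive expr :=
| Const (c : R)
| Coord (k : nat) (i : axis)
| InvRadius
| Add (e1 e2 : expr)
| Mul (e1 e2 : expr).

Fixpoint eval (e : expr) (J : jet) : R :=
  match e with
  | Const c => c
  | Coord k i => coord (Vx k i) J
  | InvRadius => / radius J
  | Add e1 e2 => eval e1 J + eval e2 J
  | Mul e1 e2 => eval e1 J * eval e2 J
  end.

(** Agreement is asked for on [dom] only, because [pd] computes the partial
    derivatives of [/ radius J] only where the radius is non-zero. *)
Definition represents (e : expr) (f : jet -> R) : Prop :=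
  forall J, dom J -> f J = eval e J.

Definition coord_diff (v : jvar) (k : nat) (i : axis) : R :=
  match v with
  | Vt => 0
  | Vx k' i' => if Nat.eqb k k' && axis_eqb i i' then 1 else 0
  end.

Fixpoint pd (v : jvar) (e : expr) : expr :=
  match e with
  | Const _ => Const 0
  | Coord k i => Const (coord_diff v k i)
  | InvRadius =>
      Mul (Add (Mul (Coord 0 X1) (Const (coord_diff v 0 X1)))
               (Mul (Coord 0 X2) (Const (coord_diff v 0 X2))))
          (Mul (Const (-1)) (Mul InvRadius (Mul InvRadius InvRadius)))
  | Add e1 e2 => Add (pd v e1) (pd v e2)
  | Mul e1 e2 => Add (Mul (pd v e1) e2) (Mul e1 (pd v e2))
  end.

(** The value at [J] of the derivation of the algebra that sends the coordinate
    [x_i^(k)] to [u k i].  The total derivative at [J] and the prolongation of a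
    vector field are both of this kind. *)
Fixpoint along (u : nat -> axis -> R) (e : expr) (J : jet) : R :=
  match e with
  | Const _ => 0
  | Coord k i => u k i
  | InvRadius =>
      (position X1 J * u 0%nat X1 + position X2 J * u 0%nat X2)
      * (-1 * (/ radius J * (/ radius J * / radius J)))
  | Add e1 e2 => along u e1 J + along u e2 J
  | Mul e1 e2 => along u e1 J * eval e2 J + eval e1 J * along u e2 J
  end.

(** * Differentiation along coordinate lines *)

Lemma dom_pos J : dom J <-> 0 < position X1 J ^ 2 + position X2 J ^ 2.
Proof.
  unfold dom; split; intros H.
  - destruct (Req_dec (position X1 J) 0) as [E1|E1];
    destruct (Req_dec (position X2 J) 0) as [E2|E2]; try tauto; nra.
  - intros [E1 E2]; rewrite E1, E2 in H; lra.
Qed.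

Lemma radius_pos J : dom J -> 0 < radius J.
Proof. intros H; apply sqrt_lt_R0, dom_pos, H. Qed.

Lemma radius_sqr J : radius J ^ 2 = position X1 J ^ 2 + position X2 J ^ 2.
Proof. apply pow2_sqrt; nra. Qed.

Lemma axis_eqb_true i j : axis_eqb i j = true -> i = j.
Proof. destruct i, j; easy. Qed.

Lemma set_coord_id v J : set_coord v J (coord v J) = J.
Proof.
  destruct J as [t z], v as [|k i]; simpl; [easy|].
  f_equal; extensionality k'; extensionality i'.
  destruct (Nat.eqb k' k && axis_eqb i' i) eqn:E; [|easy].
  apply andb_prop in E; destruct E as [Ek Ei].
  now rewrite (proj1 (Nat.eqb_eq _ _) Ek), (axis_eqb_true _ _ Ei).
Qed.

Lemma is_derive_coord v J k i s :
  is_derive (fun s => coord (Vx k i) (set_coord v J s)) s (coord_diff v k i).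
Proof.
  destruct v as [|k' i']; simpl.
  - apply @is_derive_const.
  - destruct (Nat.eqb k k' && axis_eqb i i').
    + apply @is_derive_id.
    + apply @is_derive_const.
Qed.

Lemma is_derive_inv_norm (a b : R -> R) s da db :
  is_derive a s da -> is_derive b s db -> 0 < a s ^ 2 + b s ^ 2 ->
  is_derive (fun s => / sqrt (a s ^ 2 + b s ^ 2)) s
    ((a s * da + b s * db)
     * (-1 * (/ sqrt (a s ^ 2 + b s ^ 2)
              * (/ sqrt (a s ^ 2 + b s ^ 2) * / sqrt (a s ^ 2 + b s ^ 2))))).
Proof.
  intros Da Db Hpos; pose proof (sqrt_lt_R0 _ Hpos) as Hr.
  auto_derive.
  - repeat split; try (eexists; eassumption); simpl in *; lra.
  - replace (Derive _ s) with da by (symmetry; now apply is_derive_unique).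
    replace (Derive _ s) with db by (symmetry; now apply is_derive_unique).
    replace (a s * (a s * 1) + b s * (b s * 1)) with (a s ^ 2 + b s ^ 2) by ring.
    field; lra.
Qed.

Lemma is_derive_eval e v J : dom J ->
  is_derive (fun s => eval e (set_coord v J s)) (coord v J) (eval (pd v e) J).
Proof.
  intros HJ; induction e as [c|k i| |e1 IH1 e2 IH2|e1 IH1 e2 IH2].
  - exact (is_derive_const c _).
  - apply is_derive_coord.
  - apply dom_pos in HJ.
    pose proof (is_derive_inv_norm _ _ _ _ _
      (is_derive_coord v J 0 X1 (coord v J)) (is_derive_coord v J 0 X2 (coord v J)))
      as H.
    cbv beta in H; rewrite set_coord_id in H; exact (H HJ).
  - exact (is_derive_plus _ _ _ _ _ IH1 IH2).
  - pose proof (is_derive_mult _ _ _ _ _ IH1 IH2 Rmult_comm) as H.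
    cbv beta in H; rewrite set_coord_id in H; exact H.
Qed.

(** A function known only on [dom] can still be differentiated at a point of
    [dom], since [dom] is open along every coordinate line. *)
Lemma dom_line v J : dom J ->
  locally (coord v J) (fun s => dom (set_coord v J s)).
Proof.
  intros HJ.
  assert (C : continuous (fun s => position X1 (set_coord v J s) ^ 2
                + position X2 (set_coord v J s) ^ 2) (coord v J)).
  { refine (ex_derive_continuous _ _ _); unfold position.
    assert (D : forall i, ex_derive (fun s => coord (Vx 0 i) (set_coord v J s)) (coord v J))
      by (intros i; eexists; apply is_derive_coord).
    exact (ex_derive_plus _ _ _ (ex_derive_pow _ 2 _ (D X1)) (ex_derive_pow _ 2 _ (D X2))). }
  assert (L : locally (coord v J) (fun s => 0 < position X1 (set_coord v J s) ^ 2
                + position X2 (set_coord v J s) ^ 2)).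
  { apply (C (fun y => 0 < y)); cbv beta; rewrite set_coord_id.
    exact (open_gt 0 _ (proj1 (dom_pos J) HJ)). }
  revert L; apply filter_imp.
  intros s Hs; now apply dom_pos.
Qed.

Lemma represents_is_derive e f v J : represents e f -> dom J ->
  is_derive (fun s => f (set_coord v J s)) (coord v J) (eval (pd v e) J).
Proof.
  intros Hf HJ; apply is_derive_ext_loc with (fun s => eval e (set_coord v J s)).
  - generalize (dom_line v J HJ); apply filter_imp; intros s Hs; symmetry; auto.
  - now apply is_derive_eval.
Qed.

Lemma represents_partial e f v : represents e f -> represents (pd v e) (partial v f).
Proof. intros Hf J HJ; apply is_derive_unique, represents_is_derive; auto. Qed.

Lemma represents_partials l e f :
  represents e f -> exists e', represents e' (partials l f).
Proof.
  intros Hf; induction l as [|v l [e' IH]]; simpl; [now exists e|].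
  exists (pd v e'); now apply represents_partial.
Qed.

(** * Representable functions are differential functions *)

Lemma continuous_coord k i (J : jet) : continuous (coord (Vx k i)) J.
Proof.
  intros P [eps HP]; exists eps; intros J' [_ H].
  apply HP, (H k i).
Qed.

Lemma continuous_eval e J : dom J -> continuous (eval e) J.
Proof.
  intros HJ; induction e as [c|k i| |e1 IH1 e2 IH2|e1 IH1 e2 IH2]; simpl.
  - apply continuous_const.
  - apply continuous_coord.
  - apply (continuous_comp radius Rinv).
    + apply (continuous_comp (fun J => position X1 J ^ 2 + position X2 J ^ 2) sqrt).
      * refine (continuous_plus _ _ _ _ _);
        apply (continuous_comp (position _) (fun y => y ^ 2));
        try apply continuous_coord;
        refine (ex_derive_continuous _ _ _); auto_derive; easy.
      * apply continuous_sqrt.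
    + apply continuous_Rinv, Rgt_not_eq, radius_pos, HJ.
  - exact (continuous_plus _ _ _ IH1 IH2).
  - exact (continuous_mult _ _ _ IH1 IH2).
Qed.

Lemma dom_open (J : jet) : dom J -> locally J dom.
Proof.
  intros HJ.
  set (e := Add (Mul (Coord 0 X1) (Coord 0 X1)) (Mul (Coord 0 X2) (Coord 0 X2))).
  assert (E : forall J, eval e J = position X1 J ^ 2 + position X2 J ^ 2)
    by (intros J'; unfold e; simpl; unfold position; simpl; ring).
  assert (P : 0 < eval e J) by (rewrite E; now apply dom_pos).
  assert (L : locally J (fun J' => 0 < eval e J'))
    by exact (continuous_eval e J HJ _ (open_gt 0 _ P)).
  revert L; apply filter_imp.
  intros J' H; apply dom_pos; now rewrite <- E.
Qed.

(** The algebra contains, up to agreement on [dom], all iterated partial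
    derivatives of its elements, so continuity and differentiability of its
    elements suffice. *)
Lemma represents_smooth e f : represents e f -> smooth f.
Proof.
  intros Hf l J HJ; destruct (represents_partials l _ _ Hf) as [e' He']; split.
  - apply continuous_ext_loc with (eval e').
    + generalize (dom_open J HJ); apply filter_imp; intros; symmetry; auto.
    + now apply continuous_eval.
  - intros v; eexists; now apply represents_is_derive with (e := e').
Qed.

Fixpoint order (e : expr) : nat :=
  match e with
  | Coord k _ => k
  | Const _ | InvRadius => 0
  | Add e1 e2 | Mul e1 e2 => max (order e1) (order e2)
  end.

Lemma eval_order e J J' :
  (forall k i, (k <= order e)%nat -> snd J k i = snd J' k i) -> eval e J = eval e J'.
Proof.
  induction e as [c|k i| |e1 IH1 e2 IH2|e1 IH1 e2 IH2]; simpl; intros H.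
  - easy.
  - now apply H.
  - unfold radius, position; simpl; now rewrite !H.
  - rewrite IH1, IH2; [easy| |]; intros; apply H; lia.
  - rewrite IH1, IH2; [easy| |]; intros; apply H; lia.
Qed.

Lemma represents_differential_function e f :
  represents e f -> differential_function f.
Proof.
  intros Hf; split; [|now apply represents_smooth with e].
  exists (order e); intros J J' HJ _ H.
  assert (HJ' : dom J').
  { unfold dom, position in *; simpl in *; rewrite <- !H by lia; exact HJ. }
  rewrite !Hf by assumption; now apply eval_order.
Qed.

(** * Total derivative and prolongation *)

Lemma is_series_single (a : nat -> R) n :
  (forall k, k <> n -> a k = 0) -> is_series a (a n).
Proof.
  intros H; change (is_lim_seq (sum_n a) (a n)).
  apply is_lim_seq_ext_loc with (fun _ => a n); [|apply is_lim_seq_const].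
  exists n; intros m Hm.
  assert (Hz : forall p, (p < n)%nat -> sum_n a p = 0).
  { induction p as [|p IH]; intros Hp.
    - rewrite sum_O; apply H; lia.
    - rewrite sum_Sn, IH, H by lia; apply Rplus_0_r. }
  induction Hm as [|m Hm IH].
  - destruct n as [|n]; [now rewrite sum_O|].
    rewrite sum_Sn, Hz by lia; symmetry; apply Rplus_0_l.
  - rewrite sum_Sn, <- IH, (H (S m)) by lia; symmetry; apply Rplus_0_r.
Qed.

(** The series has finite support, but giving its sum by induction on [e] avoids
    bounding that support: sums and products of expressions become sums and
    scalar multiples of convergent series. *)
Lemma is_series_along u e J :
  is_series (fun k => sum_axes (fun i => u k i * eval (pd (Vx k i) e) J))
            (along u e J).
Proof.
  induction e as [c|k i| |e1 IH1 e2 IH2|e1 IH1 e2 IH2]; unfold sum_axes in *.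
  - eapply is_series_ext; [|apply (is_series_single (fun _ => 0) 0); easy].
    intros k; simpl; ring.
  - set (a := fun k' => _).
    replace (along u (Coord k i) J) with (a k).
    + apply is_series_single; intros k' Hk; unfold a; simpl.
      rewrite (proj2 (Nat.eqb_neq k k')) by auto; simpl; ring.
    + unfold a; simpl; rewrite Nat.eqb_refl; destruct i; simpl; ring.
  - set (a := fun k => _).
    replace (along u InvRadius J) with (a 0%nat).
    + apply is_series_single; intros [|k] Hk; [easy|]; unfold a; simpl; ring.
    + unfold a; simpl; unfold position; simpl; ring.
  - eapply is_series_ext; [|apply (is_series_plus _ _ _ _ IH1 IH2)].
    intros k; cbn; ring.
  - simpl along; rewrite (Rmult_comm (along u e1 J)).
    eapply is_series_ext; [|apply (is_series_plus _ _ _ _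
      (is_series_scal (eval e2 J) _ _ IH1) (is_series_scal (eval e1 J) _ _ IH2))].
    intros k; cbn; ring.
Qed.

Lemma pd_time e J : eval (pd Vt e) J = 0.
Proof.
  induction e as [c|k i| |e1 IH1 e2 IH2|e1 IH1 e2 IH2]; simpl;
  try rewrite IH1, IH2; ring.
Qed.

Lemma series_along u e f J : represents e f -> dom J ->
  Series (fun k => sum_axes (fun i => u k i * partial (Vx k i) f J)) = along u e J.
Proof.
  intros Hf HJ; rewrite <- (is_series_unique _ _ (is_series_along u e J)).
  apply Series_ext; intros k; unfold sum_axes.
  now rewrite !(represents_partial e f _ Hf J HJ).
Qed.

(** With these values [along] is the total derivative: [x_i^(k)] goes to
    [x_i^(k+1)], and time contributes nothing because no [expr] depends on it. *)
Definition shift (J : jet) (k : nat) (i : axis) : R := coord (Vx (S k) i) J.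

Lemma Dt_along e f J : represents e f -> dom J -> Dt f J = along (shift J) e J.
Proof.
  intros Hf HJ; unfold Dt.
  rewrite (represents_partial e f _ Hf J HJ), pd_time, Rplus_0_l.
  now apply (series_along (shift J)).
Qed.

Lemma pr_along v e f J : represents e f -> dom J ->
  pr v f J = along (fun k i => Nat.iter k Dt (v i) J) e J.
Proof. intros Hf HJ; now apply (series_along (fun k i => Nat.iter k Dt (v i) J)). Qed.

(** * Symmetries from conservation laws *)

Definition Opp (e : expr) : expr := Mul (Const (-1)) e.
Definition Sub (e1 e2 : expr) : expr := Add e1 (Opp e2).
Definition Sqr (e : expr) : expr := Mul e e.
Definition x (i : axis) : expr := Coord 0 i.
Definition dx (i : axis) : expr := Coord 1 i.
Definition speed2_expr : expr := Add (Sqr (dx X1)) (Sqr (dx X2)).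
Definition L_expr : expr := Add (Mul (Const (/ 2)) speed2_expr) InvRadius.

Ltac eval_tac :=
  unfold kepler_L, energy, angular_momentum, LRL, speed2, pos_dot_vel,
    v_H, v_m, v_A1, v_A2, Rdiv, velocity, position; simpl; ring.

Lemma represents_kepler_L : represents L_expr kepler_L.
Proof. intros J _; eval_tac. Qed.

(** The characteristic of a conservation law is a variational symmetry, with
    [K = Q . x' - P]: the accelerations in [d/dt (Q . x')] and in [Q . N]
    cancel, leaving [Q . dL/dx + dQ/dt . x' = pr Q (L)]. *)
Lemma associated_of_characteristic P Q p q :
  represents p P -> (forall i, represents (q i) (Q i)) ->
  (forall J, dom J ->
     along (shift J) p J = sum_axes (fun i => Q i J * kepler_N i J)) ->
  associated_symmetry kepler_L kepler_N P Q.
Proof.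
  intros Hp Hq HPQ.
  assert (HK : represents
    (Sub (Add (Mul (q X1) (dx X1)) (Mul (q X2) (dx X2))) p)
    (fun J => Q X1 J * velocity X1 J + Q X2 J * velocity X2 J - P J)).
  { intros J HJ; rewrite (Hp J HJ), !(Hq _ J HJ); unfold velocity; simpl; ring. }
  split; split.
  - intros i; apply represents_differential_function with (q i), Hq.
  - eexists; split; [eapply represents_differential_function, HK|].
    intros J HJ; rewrite (Dt_along _ _ _ HK HJ), (pr_along _ _ _ _ represents_kepler_L HJ).
    simpl; rewrite (HPQ J HJ), !(Dt_along _ _ _ (Hq _) HJ).
    unfold sum_axes, kepler_N, shift, acceleration, position.
    rewrite !(Hq _ J HJ); simpl.
    pose proof (radius_pos J HJ); field; lra.
  - now apply represents_differential_function with p.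
  - intros J HJ; rewrite (Dt_along _ _ _ Hp HJ); auto.
Qed.

(** * Uniqueness of the characteristic *)

Lemma continuous_punctured_zero (g : R -> R) a :
  continuous g a -> (forall s, s <> a -> g s = 0) -> g a = 0.
Proof.
  intros C H; destruct (Req_dec (g a) 0) as [|N]; [easy|exfalso].
  destruct (C _ (open_neq 0 _ N)) as [eps He].
  apply (He (a + eps / 2)).
  - refine (norm_compat1 _ _ _ _). unfold norm, minus; simpl.
    pose proof (cond_pos eps). unfold abs, plus, opp; simpl.
    rewrite Rabs_right; lra.
  - apply H; pose proof (cond_pos eps); lra.
Qed.

(** Two characteristics of one conservation law can differ only by a field
    orthogonal to [N] on all jets.  Moving a single acceleration away from a jet
    with [N = 0] turns [N] into a multiple of a basis vector, which isolates one
    component of the difference. *)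
Lemma characteristic_unique P v w :
  (forall i, smooth (v i)) -> (forall i, smooth (w i)) ->
  has_characteristic kepler_N P v -> has_characteristic kepler_N P w ->
  agree_on_solutions kepler_N w v.
Proof.
  intros Sv Sw [_ Hv] [_ Hw] J HJ HN i.
  set (a := Vx 2 i).
  set (g := fun s => w i (set_coord a J s) - v i (set_coord a J s)).
  assert (G : g (coord a J) = 0).
  { apply continuous_punctured_zero.
    - refine (ex_derive_continuous _ _ _); refine (ex_derive_minus _ _ _ _ _).
      + exact (proj2 (Sw i nil J HJ) a).
      + exact (proj2 (Sv i nil J HJ) a).
    - intros s Hs.
      set (Js := set_coord a J s).
      (* [s - coord a J] is the value of [N_i] at [Js], as [N_i = 0] at [J]. *)
      assert (E : w i Js * (s - coord a J) = v i Js * (s - coord a J)).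
      { assert (HJs : dom Js) by exact HJ.
        pose proof (Hv Js HJs) as E1; rewrite (Hw Js HJs) in E1.
        unfold sum_axes in E1.
        assert (Er : radius Js = radius J) by reflexivity.
        pose proof (HN X1) as N1; pose proof (HN X2) as N2.
        unfold kepler_N in *; rewrite Er in E1.
        destruct i.
        + change (acceleration X1 Js) with s in E1.
          change (acceleration X2 Js) with (acceleration X2 J) in E1.
          change (position X1 Js) with (position X1 J) in E1.
          change (position X2 Js) with (position X2 J) in E1.
          rewrite N2 in E1; change (coord a J) with (acceleration X1 J).
          replace (s - acceleration X1 J)
            with (s + position X1 J / radius J ^ 3) by lra; lra.
        + change (acceleration X2 Js) with s in E1.
          change (acceleration X1 Js) with (acceleration X1 J) in E1.
          change (position X1 Js) with (position X1 J) in E1.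
          change (position X2 Js) with (position X2 J) in E1.
          rewrite N1 in E1; change (coord a J) with (acceleration X2 J).
          replace (s - acceleration X2 J)
            with (s + position X2 J / radius J ^ 3) by lra; lra. }
      apply Rmult_eq_reg_r in E; [|lra].
      unfold g; fold Js; lra. }
  unfold g in G; rewrite set_coord_id in G; lra.
Qed.

Lemma the_associated_of_characteristic P Q p q :
  represents p P -> (forall i, represents (q i) (Q i)) ->
  (forall J, dom J ->
     along (shift J) p J = sum_axes (fun i => Q i J * kepler_N i J)) ->
  is_the_associated_symmetry kepler_L kepler_N P Q.
Proof.
  intros Hp Hq HPQ.
  assert (A := associated_of_characteristic P Q p q Hp Hq HPQ); split; [exact A|].
  destruct A as [[A1 _] A2]; intros w [[W1 _] W2].
  apply characteristic_unique with P; auto.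
  - intros i; apply A1.
  - intros i; apply W1.
Qed.

(** * The Kepler conserved quantities *)

Definition pos_dot_vel_expr : expr := Add (Mul (x X1) (dx X1)) (Mul (x X2) (dx X2)).

Definition energy_expr : expr := Sub (Mul (Const (/ 2)) speed2_expr) InvRadius.
Definition angular_momentum_expr : expr :=
  Sub (Mul (x X1) (dx X2)) (Mul (x X2) (dx X1)).
Definition LRL_expr (i : axis) : expr :=
  Sub (Sub (Mul (x i) speed2_expr) (Mul (dx i) pos_dot_vel_expr))
      (Mul (x i) InvRadius).

Definition v_m_expr (i : axis) : expr :=
  match i with X1 => Opp (x X2) | X2 => x X1 end.
Definition v_A1_expr (i : axis) : expr :=
  match i with
  | X1 => Opp (Mul (x X2) (dx X2))
  | X2 => Sub (Mul (Const 2) (Mul (x X1) (dx X2))) (Mul (dx X1) (x X2))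
  end.
Definition v_A2_expr (i : axis) : expr :=
  match i with
  | X1 => Sub (Mul (Const 2) (Mul (x X2) (dx X1))) (Mul (x X1) (dx X2))
  | X2 => Opp (Mul (x X1) (dx X1))
  end.

(** After clearing denominators the powers of [r] on the two sides differ, for
    the Laplace-Runge-Lenz vector, by one substitution of [r^2]. *)
Ltac characteristic_tac :=
  intros J HJ; pose proof (radius_pos J HJ) as Hr; pose proof (radius_sqr J) as Hs;
  unfold kepler_N, sum_axes, acceleration, v_H, v_m, v_A1, v_A2, velocity in *;
  simpl; unfold shift, position in *; simpl coord in *;
  field_simplify_eq; [ring [Hs]|lra].

Theorem proposition2p12 :
  is_the_associated_symmetry kepler_L kepler_N energy v_H /\
  is_the_associated_symmetry kepler_L kepler_N angular_momentum v_m /\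
  is_the_associated_symmetry kepler_L kepler_N (LRL X1) v_A1 /\
  is_the_associated_symmetry kepler_L kepler_N (LRL X2) v_A2.
Proof.
  split; [|split; [|split]].
  - apply the_associated_of_characteristic with energy_expr dx.
    + intros J _; eval_tac.
    + intros [|] J _; eval_tac.
    + characteristic_tac.
  - apply the_associated_of_characteristic with angular_momentum_expr v_m_expr.
    + intros J _; eval_tac.
    + intros [|] J _; eval_tac.
    + characteristic_tac.
  - apply the_associated_of_characteristic with (LRL_expr X1) v_A1_expr.
    + intros J _; eval_tac.
    + intros [|] J _; eval_tac.
    + characteristic_tac.
  - apply the_associated_of_characteristic with (LRL_expr X2) v_A2_expr.
    + intros J _; eval_tac.
    + intros [|] J _; eval_tac.
    + characteristic_tac.
Qed.
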